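(* Let $a,b\in\mathbb Z$. Every generic solution of the hypergeometric equation $$(\Delta-[-a])(\Delta-[-b])u=d\Delta u$$ is strongly singular. Explicitly: let $(c_i)_{i\ge 0}$ be a sequence in $\overline{K}_c$ satisfying $$\left(c_{i+2}^{1/q}-c_{i+2}\right)+c_{i+1}^{1/q}[i+1]^{1/q}-c_{i+1}\big([i]+[i+1]-[-a]-[-b]\big)-c_i\big([i]-[-a]\big)\big([i]-[-b]\big)=0,\quad i=0,1,2,\ldots$$ (equivalently, such that $u(t)=\sum_{i\ge 0}c_if_i(t)$, $t\in\mathbf F_q[x]$, is a solution of the equation on $\mathbf F_q[x]$), and suppose that the solution is generic, i.e. there is an $N$ such that for all $n\ge N$ the coefficient $c_n$ is chosen as a solution $z$ with $|z|=1$ of the corresponding equation $z^{1/q}-z=v$. Then the series $\sum_{i\ge 0}c_if_i(t)$ does not converge at any point $t\in O\setminus\mathbf F_q[x]$.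
   Context: Let $q$ be a power of a prime $p$, and let $K=\mathbf F_q((x))$ with absolute value $|t|=q^{-N}$ for $t=\sum_{j\ge N}\xi_jx^j$, $\xi_N\ne 0$, and $|0|=0$. Let $O=\{t\in K:|t|\le 1\}=\mathbf F_q[[x]]$, and let $\overline{K}_c$ be the completion of an algebraic closure of $K$ with the uniquely extended absolute value. For $j\in\mathbb Z$ put $[j]=x^{q^j}-x\in\overline{K}_c$ (for negative $j$, $x^{q^j}$ is the unique $q^{|j|}$-th root of $x$). Carlitz polynomials: $f_i=D_i^{-1}e_i$, with $D_0=1$, $D_i=[i][i-1]^q\cdots[1]^{q^{i-1}}$, $e_0(t)=t$, $e_i(t)=\prod_{\omega\in\mathbf F_q[x],\,\deg\omega<i}(t-\omega)$ for $i\ge 1$ (including $\omega=0$). For $t\in\mathbf F_q[x]$ only finitely many terms of $\sum c_if_i(t)$ are non-zero. Operators: $(\Delta u)(t)=u(xt)-xu(t)$ and $d=\sqrt[q]{\ }\circ\Delta$; they are well defined on $\mathbf F_q$-linear functions on $\mathbf F_q[x]$. Given $c_i,c_{i+1}$, the recursion determines $c_{i+2}$ as a solution $z=c_{i+2}$ of an equation $z^{1/q}-z=v$, where $v$ depends on $c_i,c_{i+1}$; the initial coefficients $c_0,c_1\in\overline{K}_c$ are arbitrary. A solution is called generic if, starting from a certain step of finding the coefficients $c_n$, one always takes a solution $z$ with $|z|=1$. A formal series $\sum c_if_i(t)$ is called strongly singular if it converges at no point $t\in O\setminus\mathbf F_q[x]$. *)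

(* Defs.v *)
(* MathComp-Analysis world. *)
From HB Require Import structures.
From mathcomp Require Import all_boot all_order all_algebra.
From mathcomp Require Import all_classical all_reals all_analysis.

Set Implicit Arguments.
Unset Strict Implicit.
Unset Printing Implicit Defensive.

Import Order.TTheory GRing.Theory Num.Theory.
Import numFieldNormedType.Exports.

Local Open Scope classical_set_scope.
Local Open Scope ring_scope.

Section Carlitz.

(* F plays the role of F_q, so q = #|F|.  L is the valued field (L, abs), which
   receives F through iota and contains the indeterminate x; it is required to
   be the completion of an algebraic closure of F((x)) by the record
   completed_alg_closure below. *)
Variables (R : realType) (F : finFieldType) (L : fieldType).
Variables (iota : {rmorphism F -> L}) (x : L) (abs : L -> R).

Local Notation q := #|F|.

Definition converges_to (s : nat -> L) (l : L) : Prop :=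
  abs (s n - l) @[n --> \oo] --> (0 : R).

Definition converges (s : nat -> L) : Prop := exists l, converges_to s l.

Definition cauchy_seq (s : nat -> L) : Prop :=
  forall e : R, 0 < e ->
    exists N : nat, forall m n, (N <= m)%N -> (N <= n)%N -> abs (s m - s n) < e.

(* t = \sum_(j >= N) xi j * x ^ j *)
Definition laurent_sum (N : int) (xi : int -> F) (t : L) : Prop :=
  converges_to
    (fun n => \sum_(k < n) iota (xi (N + k%:Z)) * x ^ (N + k%:Z)) t.

(* The subfield K = F((x)) of L: since L is complete, each formal Laurent
   series has a sum in L, and by the axiom abs_laurent below the sum determines
   the series. *)
Definition in_K (t : L) : Prop := exists N xi, laurent_sum N xi t.

Definition alg_over_K (y : L) : Prop :=
  exists p : {poly L}, [/\ p != 0, (forall i, in_K p`_i) & root p y].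

(* (L, abs) is the completion of an algebraic closure of K = F((x)).  Here
   abs_laurent says that abs extends the absolute value of K, alg_closedK that
   the algebraic closure of K in L is algebraically closed, and alg_denseK and
   abs_complete that L is its completion.  These properties determine
   (L, iota, x, abs) up to isometric isomorphism, as the absolute value of K
   extends uniquely to an algebraic closure. *)
Record completed_alg_closure : Prop := CompletedAlgClosure {
  abs_eq0 : forall y, (abs y == 0) = (y == 0);
  abs_ge0 : forall y, 0 <= abs y;
  absM : forall y z, abs (y * z) = abs y * abs z;
  abs_ultra : forall y z, abs (y + z) <= Num.max (abs y) (abs z);
  abs_laurent : forall N xi t,
    laurent_sum N xi t -> xi N != 0 -> abs t = q%:R ^ (- N);
  abs_complete : forall s, cauchy_seq s -> converges s;
  alg_closedK : forall p : {poly L},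
    (forall i, alg_over_K p`_i) -> (1 < size p)%N ->
    exists2 y, alg_over_K y & root p y;
  alg_denseK : forall z (e : R), 0 < e ->
    exists2 y, alg_over_K y & abs (z - y) < e
}.

Definition in_O (t : L) : Prop := in_K t /\ abs t <= 1.

Definition of_poly (w : {poly F}) : L := (map_poly iota w).[x].

Definition in_Fqx (t : L) : Prop := exists w : {poly F}, t = of_poly w.

(* The y such that y ^+ m = z; it is used only when m is a power of q, in which
   case such a y exists and is unique under completed_alg_closure. *)
Definition nthroot (m : nat) (z : L) : L := xget 0 [set y | y ^+ m = z].

Local Notation qroot := (nthroot q).

(* x ^ (q ^ j) for j in int; recall that Negz n is - n.+1. *)
Definition xq (j : int) : L :=
  match j with
  | Posz n => x ^+ (q ^ n)
  | Negz n => nthroot (q ^ n.+1) x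
  end.

Definition br (j : int) : L := xq j - x.

Definition carlitz_D (i : nat) : L := \prod_(k < i) br (i - k)%N ^+ (q ^ k).

(* The row vectors of size i enumerate, through rVpoly, the polynomials of
   degree < i; for i = 0 the only factor is t - 0. *)
Definition carlitz_e (i : nat) (t : L) : L :=
  \prod_(w : 'rV[F]_i) (t - of_poly (rVpoly w)).

Definition carlitz_f (i : nat) (t : L) : L := (carlitz_D i)^-1 * carlitz_e i t.

Lemma carlitz_f_eq0 (i : nat) (t : {poly F}) :
  (size t <= i)%N -> carlitz_f i (of_poly t) = 0.
Proof.
move=> ti; rewrite /carlitz_f /carlitz_e (bigD1 (poly_rV t)) //= poly_rV_K //.
by rewrite subrr mul0r mulr0.
Qed.

(* u(t) = \sum_(i >= 0) c i * f_i(t) for t in F[x]; the omitted terms vanish by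
   carlitz_f_eq0. *)
Definition carlitz_sum (c : nat -> L) (t : {poly F}) : L :=
  \sum_(i < size t) c i * carlitz_f i (of_poly t).

Definition carlitz_Delta (u : {poly F} -> L) (t : {poly F}) : L :=
  u ('X * t) - x * u t.

Definition carlitz_d (u : {poly F} -> L) (t : {poly F}) : L :=
  qroot (carlitz_Delta u t).

(* The operator Delta - alpha. *)
Definition carlitz_Delta_sub (alpha : L) (u : {poly F} -> L) (t : {poly F}) : L :=
  carlitz_Delta u t - alpha * u t.

Definition hypergeometric_eq (a b : int) (u : {poly F} -> L) : Prop :=
  forall t,
    carlitz_Delta_sub (br (- a)) (carlitz_Delta_sub (br (- b)) u) t
    = carlitz_d (carlitz_Delta u) t.

Definition hypergeometric_rec (a b : int) (c : nat -> L) : Prop :=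
  forall i : nat,
    (qroot (c i.+2) - c i.+2)
    + qroot (c i.+1) * qroot (br i.+1)
    - c i.+1 * (br i + br i.+1 - br (- a) - br (- b))
    - c i * (br i - br (- a)) * (br i - br (- b)) = 0.

(* A solution of the recursion whose coefficients are, from some step on,
   chosen of absolute value 1. *)
Definition generic_solution (a b : int) (c : nat -> L) : Prop :=
  hypergeometric_rec a b c /\
  exists N : nat, forall n, (N <= n)%N -> abs (c n) = 1.

Definition strongly_singular (c : nat -> L) : Prop :=
  forall t, in_O t -> ~ in_Fqx t ->
    ~ converges (fun n => \sum_(i < n) c i * carlitz_f i t).

End Carlitz.

(* Main.v *)
(* Both sides of the equivalence are computed on the basis (f_i): the identities
   e_(i+1) = e_i^q - D_i^(q-1) e_i and e_(i+1)(xt) = x e_(i+1)(t) + [i+1] e_i(t)^q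
   give Delta f_(i+1) = f_i^q = f_i + [i+1] f_(i+1), hence d f_(i+1) = f_i, and a
   series on F_q[x] determines its coefficients because f_i(x^i) = 1.

   For strong singularity, let t = \sum_j xi_j x^j lie in O but not in F_q[x].
   If xi_i <> 0, then t differs from a polynomial of degree < i by an element
   of absolute value |x^i|, so the ultrametric inequality gives
   |e_i(t)| = |e_i(x^i)| = |D_i|, i.e. |f_i(t)| = 1.  This happens for infinitely
   many i, so the terms c_i f_i(t) do not tend to 0 when |c_i| = 1 eventually. *)
Require Import Defs.
From HB Require Import structures.
From mathcomp Require Import all_boot all_order all_algebra.
From mathcomp Require Import finfield.
From mathcomp Require Import all_classical all_reals all_analysis.
From mathcomp Require Import ring zify.

Set Implicit Arguments.
Unset Strict Implicit.
Unset Printing Implicit Defensive.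

Import Order.TTheory GRing.Theory Num.Theory.
Import numFieldNormedType.Exports.

Local Open Scope ring_scope.

(** * Ultrametric estimates and convergence in [L] *)

Section Valuation.
Variables (R : realType) (F : finFieldType) (L : fieldType).
Variables (iota : {rmorphism F -> L}) (x : L) (abs : L -> R).
Hypothesis hL : completed_alg_closure iota x abs.
Local Notation q := #|F|.

Lemma abs0 : abs 0 = 0.
Proof. by apply/eqP; rewrite (abs_eq0 hL). Qed.

Lemma abs1 : abs 1 = 1.
Proof.
have n0 : abs 1 != 0 by rewrite (abs_eq0 hL) oner_eq0.
by apply: (mulfI n0); rewrite mulr1 -(absM hL) mulr1.
Qed.

Lemma absX (y : L) (n : nat) : abs (y ^+ n) = abs y ^+ n.
Proof. by elim: n => [|n IH]; rewrite ?abs1 // !exprS (absM hL) IH. Qed.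

Lemma absV (y : L) : abs y^-1 = (abs y)^-1.
Proof.
have [->|y0] := eqVneq y 0; first by rewrite invr0 abs0 invr0.
have n0 : abs y != 0 by rewrite (abs_eq0 hL).
by apply: (mulfI n0); rewrite -(absM hL) !divff ?abs1.
Qed.

Lemma absN (y : L) : abs (- y) = abs y.
Proof.
apply/eqP; rewrite -(@eqrXn2 _ 2) ?(abs_ge0 hL) // -!absX.
by rewrite sqrrN.
Qed.

Lemma abs_sub (y z : L) : abs (y - z) = abs (z - y).
Proof. by rewrite -absN opprB. Qed.

Lemma abs_add_lt (y z : L) (e : R) : abs y < e -> abs z < e -> abs (y + z) < e.
Proof.
move=> ye ze; apply: le_lt_trans (abs_ultra hL y z) _.
by rewrite gt_max ye.
Qed.

Lemma abs_sub_lt (y z : L) (e : R) : abs y < e -> abs z < e -> abs (y - z) < e.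
Proof. by move=> ye ze; apply: abs_add_lt; rewrite ?absN. Qed.

Lemma abs_add_dominant (y z : L) : abs z < abs y -> abs (y + z) = abs y.
Proof.
move=> zy; apply/le_anti/andP; split.
  by apply: le_trans (abs_ultra hL _ _) _; rewrite ge_max lexx ltW.
(* Otherwise [y = (y + z) - z] would be a difference of two elements smaller than [abs y]. *)
rewrite leNgt; apply/negP => yzy.
by have := abs_sub_lt yzy zy; rewrite addrK ltxx.
Qed.

Lemma abs_prod (I : finType) (G : I -> L) :
  abs (\prod_i G i) = \prod_i abs (G i).
Proof. exact: (big_morph _ (absM hL) abs1). Qed.

Lemma converges_toP (s : nat -> L) (l : L) :
  converges_to abs s l <->
  forall e : R, 0 < e ->
    exists N : nat, forall n, (N <= n)%N -> abs (s n - l) < e.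
Proof.
split=> [h e e0|h].
  have /cvgr0Pnorm_lt /(_ e e0) [N _ hN] := h.
  by exists N => n /hN /=; rewrite ger0_norm ?(abs_ge0 hL).
apply/cvgr0Pnorm_lt => e /h [N hN]; exists N => // n /= /hN.
by rewrite ger0_norm ?(abs_ge0 hL).
Qed.

Lemma eventually_const_converges (s : nat -> L) (l : L) (N : nat) :
  (forall n, (N <= n)%N -> s n = l) -> converges_to abs s l.
Proof.
move=> h; apply/converges_toP => e e0; exists N => n /h ->.
by rewrite subrr abs0.
Qed.


Lemma finNzRing_gt0 : (0 < q)%N.
Proof. exact: ltnW (finNzRing_gt1 F). Qed.

(** * Absolute values of constants, of [x] and of polynomials; Laurent expansions *)

Lemma laurent_sum_const (a : F) :
  laurent_sum iota x abs 0 (fun j => if j == 0 then a else 0) (iota a).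
Proof.
apply: (@eventually_const_converges _ _ 1) => -[//|n] _.
rewrite big_ord_recl big1 => [|i _]; first by rewrite mulr1 addr0.
by rewrite add0r /= rmorph0 mul0r.
Qed.

Lemma in_K_iota (a : F) : in_K iota x abs (iota a).
Proof. by do 2 eexists; exact: laurent_sum_const. Qed.

Lemma abs_iota (a : F) : a != 0 -> abs (iota a) = 1.
Proof. by move=> a0; rewrite (abs_laurent hL (laurent_sum_const a)). Qed.

Lemma abs_iota_le (a : F) : abs (iota a) <= 1.
Proof.
by have [->|/abs_iota->//] := eqVneq a 0; rewrite rmorph0 abs0.
Qed.

Lemma abs_x : abs x = q%:R^-1.
Proof.
rewrite -[RHS]/(q%:R ^ (- 1)).
apply: (abs_laurent hL (xi := fun j => if j == 1 then 1 else 0)); last exact: oner_neq0.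
apply: (@eventually_const_converges _ _ 1) => -[//|n] _.
rewrite big_ord_recl big1 => [|i _]; first
  by rewrite !addr0 eqxx rmorph1 mul1r expr1z.
by rewrite -[1 + _]/((1 + i.+1)%N%:Z) /= rmorph0 mul0r.
Qed.

Lemma abs_x_gt0 : 0 < abs x.
Proof. by rewrite abs_x invr_gt0 ltr0n finNzRing_gt0. Qed.

Lemma abs_x_lt1 : abs x < 1.
Proof. by rewrite abs_x invf_lt1 ?ltr0n ?finNzRing_gt0 // ltr1n finNzRing_gt1. Qed.

Local Notation of_poly := (of_poly iota x).

Lemma of_polyD (v w : {poly F}) : of_poly (v + w) = of_poly v + of_poly w.
Proof. by rewrite /of_poly rmorphD hornerD. Qed.

Lemma of_polyN (w : {poly F}) : of_poly (- w) = - of_poly w.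
Proof. by rewrite /of_poly rmorphN hornerN. Qed.

Lemma of_polyM (v w : {poly F}) : of_poly (v * w) = of_poly v * of_poly w.
Proof. by rewrite /of_poly rmorphM hornerM. Qed.

Lemma of_polyZ (a : F) (w : {poly F}) : of_poly (a *: w) = iota a * of_poly w.
Proof. by rewrite /of_poly linearZ hornerZ. Qed.

Lemma of_polyC (a : F) : of_poly a%:P = iota a.
Proof. by rewrite /of_poly map_polyC hornerC. Qed.

Lemma of_poly0 : of_poly 0 = 0.
Proof. by rewrite /of_poly rmorph0 horner0. Qed.

Lemma of_polyX : of_poly 'X = x.
Proof. by rewrite /of_poly map_polyX hornerX. Qed.

Lemma of_polyXn (i : nat) : of_poly 'X^i = x ^+ i.
Proof. by rewrite /of_poly map_polyXn hornerXn. Qed.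

Lemma abs_of_poly_le1 (w : {poly F}) : abs (of_poly w) <= 1.
Proof.
elim/poly_ind: w => [|w a IH]; first by rewrite of_poly0 abs0.
rewrite of_polyD of_polyM of_polyX of_polyC.
apply: le_trans (abs_ultra hL _ _) _; rewrite ge_max abs_iota_le andbT.
by rewrite (absM hL) mulr_ile1 ?(abs_ge0 hL) // ltW ?abs_x_lt1.
Qed.

(** The lowest non-zero term of [w] dominates, and its exponent is less than [i]. In the Horner
    induction a non-zero constant term has absolute value 1, while a zero one lets a factor [x] be
    cancelled. *)
Lemma abs_of_poly_gt (w : {poly F}) (i : nat) :
  w != 0 -> (size w <= i)%N -> abs x ^+ i < abs (of_poly w).
Proof.
elim/poly_ind: w i => [|w a IH] [|i]; rewrite ?eqxx // => w0 sw.
  by move: sw w0; rewrite leqn0 size_poly_eq0 => ->.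
rewrite of_polyD of_polyM of_polyX of_polyC.
have [a0|a0] := eqVneq a 0; last first.
  rewrite addrC abs_add_dominant abs_iota ?exprn_ilt1 ?(abs_ge0 hL) ?abs_x_lt1 //.
  rewrite (absM hL); apply: le_lt_trans abs_x_lt1.
  by rewrite ler_piMl ?(abs_ge0 hL) ?abs_of_poly_le1.
move: w0 sw; rewrite a0 !rmorph0 !addr0 (absM hL) exprSr => w0 sw.
have {}w0 : w != 0 by apply: contraNneq w0 => ->; rewrite mul0r.
by rewrite ltr_pM2r ?abs_x_gt0 // IH // -ltnS -size_mulX.
Qed.

Lemma of_poly_eq0 (w : {poly F}) : (of_poly w == 0) = (w == 0).
Proof.
apply/eqP/eqP => [h|->]; last exact: of_poly0.
apply/eqP/negPn/negP => w0; have := abs_of_poly_gt w0 (leqnn _).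
by rewrite h abs0 ltNge exprn_ge0 ?(abs_ge0 hL).
Qed.

(** Together with [abs_laurent], this gives the distance from [t] to a partial sum whenever the next
    coefficient is non-zero. *)
Lemma laurent_sum_tail (N : int) (xi : int -> F) (t : L) (m : nat) :
  laurent_sum iota x abs N xi t ->
  laurent_sum iota x abs (N + m%:Z) xi
    (t - \sum_(k < m) iota (xi (N + k%:Z)) * x ^ (N + k%:Z)).
Proof.
move=> /converges_toP h; apply/converges_toP => e /h [M hM].
exists M => n Mn; have := hM (m + n)%N (leq_trans Mn (leq_addl _ _)).
rewrite big_split_ord /= opprB addrA [X in abs (X - _)]addrC.
by congr (abs (_ + _ - _) < _); apply: eq_bigr => i _; rewrite PoszD addrA.
Qed.

Lemma laurent_sum_unique0 (N : int) (xi : int -> F) (t : L) :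
  (forall k : nat, xi (N + k%:Z) = 0) -> laurent_sum iota x abs N xi t -> t = 0.
Proof.
move=> xi0 /converges_toP h; apply/eqP; rewrite -(abs_eq0 hL).
have := abs_ge0 hL t; rewrite le_eqVlt => /orP[/eqP<-//|/h [M /(_ M (leqnn M))]].
rewrite big1 => [|k _]; first by rewrite sub0r absN ltxx.
by rewrite xi0 rmorph0 mul0r.
Qed.

(** If the first non-zero coefficient had a negative exponent, [abs_laurent] would give
    [abs t > 1]. *)
Lemma laurent_sum_integral (N : int) (xi : int -> F) (t : L) (k : nat) :
  laurent_sum iota x abs N xi t -> abs t <= 1 -> N + k%:Z < 0 ->
  xi (N + k%:Z) = 0.
Proof.
move=> ht t1; elim/ltn_ind: k => k IH k0; apply/eqP/negPn/negP => xk.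
have := laurent_sum_tail k ht; rewrite big1 => [|i _].
  rewrite subr0 => /(abs_laurent hL) /(_ xk) abst.
  move: t1; rewrite abst leNgt; case: (N + _) k0 => // j _.
  by rewrite NegzE opprK -exprnP exprn_egt1 // ltr1n finNzRing_gt1.
rewrite IH ?rmorph0 ?mul0r //.
by apply: le_lt_trans k0; rewrite lerD2l lez_nat ltnW.
Qed.

Lemma laurent_partial_poly (N : int) (xi : int -> F) (t : L) (m i : nat) :
  laurent_sum iota x abs N xi t -> abs t <= 1 -> N + m%:Z = i%:Z ->
  exists2 w : {poly F}, (size w <= i)%N &
    \sum_(k < m) iota (xi (N + k%:Z)) * x ^ (N + k%:Z) = of_poly w.
Proof.
move=> ht t1 Nm.
(* The degree bound [i] stays fixed while the partial sum grows, so that only exponents below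
   [N + m = i] occur. *)
have: forall n, (n <= m)%N -> exists2 w : {poly F}, (size w <= i)%N &
    \sum_(k < n) iota (xi (N + k%:Z)) * x ^ (N + k%:Z) = of_poly w.
  elim=> [|n IH] nm; first by exists 0; rewrite ?size_poly0 // big_ord0 of_poly0.
  have [w sw ew] := IH (ltnW nm); rewrite big_ord_recr /= ew.
  (* A term with negative exponent is zero because [t] is integral. *)
  case Nn : (N + n%:Z) => [j|j]; last first.
    exists w => //; rewrite -Nn (laurent_sum_integral ht) ?Nn //.
    by rewrite rmorph0 mul0r addr0.
  exists (w + xi j *: 'X^j); last by rewrite of_polyD of_polyZ of_polyXn.
  apply: leq_trans (size_polyD _ _) _; rewrite geq_max sw.
  apply: leq_trans (size_scale_leq _ _) _; rewrite size_polyXn; lia.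
exact.
Qed.

End Valuation.

(** * Additivity and injectivity of the [q]-power map *)

Section Frobenius.
Variables (F : finFieldType) (L : fieldType) (iota : {rmorphism F -> L}).
Local Notation q := #|F|.

Lemma pchar_card_pnat (p r : nat) :
  prime p -> q = (p ^ r)%N -> [pchar L].-nat q.
Proof.
move=> p_pr cardF; rewrite cardF pnatX; apply/orP; left.
rewrite pnatE // (fmorph_pchar iota).
exact: (card_finPcharP cardF).
Qed.

Hypothesis qL : [pchar L].-nat q.

Lemma frobD (y z : L) : (y + z) ^+ q = y ^+ q + z ^+ q.
Proof. exact: exprDn_pchar. Qed.

Lemma frobB (y z : L) : (y - z) ^+ q = y ^+ q - z ^+ q.
Proof. by rewrite frobD exprNn_pchar. Qed.

Lemma frob_sum (n : nat) (G : 'I_n -> L) :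
  (\sum_i G i) ^+ q = \sum_i G i ^+ q.
Proof.
apply: (big_morph _ frobD); rewrite expr0n.
by rewrite gtn_eqF // ltnW ?finNzRing_gt1.
Qed.

Lemma frob_inj : injective (fun y : L => y ^+ q).
Proof.
move=> y z /= yz; apply/eqP; rewrite -subr_eq0.
by have := frobB y z; rewrite yz subrr => /eqP; rewrite expf_eq0 => /andP[].
Qed.

Lemma iota_frob (a : F) : iota a ^+ q = iota a.
Proof. by rewrite -rmorphXn expf_card. Qed.

(** This is the factorisation of [X^q - X] over [F], evaluated at [y / z] and multiplied by
    [z ^+ q]. *)
Lemma prod_sub_iota (y z : L) : z != 0 ->
  \prod_a (y - iota a * z) = y ^+ q - z ^+ q.-1 * y.
Proof.
move=> z0; have q0 : (0 < q)%N by rewrite ltnW ?finNzRing_gt1.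
have -> : \prod_a (y - iota a * z) = \prod_a (z * (y / z - iota a)).
  by apply: eq_bigr => a _; rewrite mulrBr mulrCA divff // mulr1 mulrC.
rewrite big_split /= prodr_const.
have /(congr1 (fun f => (map_poly iota f).[y / z])) := finField_genPoly F.
rewrite rmorphB /= map_polyXn map_polyX !hornerE => /esym.
rewrite rmorph_prod horner_prod.
rewrite (eq_bigr (fun a => y / z - iota a)) => [->|a _]; last first.
  by rewrite rmorphB /= map_polyX map_polyC !hornerE.
rewrite mulrBr exprMn mulrCA exprVn divff ?expf_neq0 // mulr1.
by rewrite -[in X in _ - X](prednK q0) exprSr -mulrA; congr (_ - _ * _);
   rewrite mulrCA divff // mulr1.
Qed.

End Frobenius.

(** * Existence and uniqueness of [q]-th roots in [L] *)

Section Roots.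
Variables (R : realType) (F : finFieldType) (L : fieldType).
Variables (iota : {rmorphism F -> L}) (x : L) (abs : L -> R).
Hypothesis hL : completed_alg_closure iota x abs.
Local Notation q := #|F|.
Hypothesis qL : [pchar L].-nat q.

Lemma alg_over_K_iota (a : F) : alg_over_K iota x abs (iota a).
Proof.
exists ('X - (iota a)%:P); split; rewrite ?polyXsubC_eq0 ?root_XsubC //.
rewrite -(map_polyX iota) -(map_polyC iota) -rmorphB => i; rewrite coef_map.
exact: in_K_iota.
Qed.

(** The sign lets [X^q + y] be used, whose coefficients are [y] itself and images of elements of
    [F]. *)
Lemma alg_over_K_root (y : L) : alg_over_K iota x abs y ->
  exists z : L, z ^+ q = - y.
Proof.
move=> ya; have q0 := finNzRing_gt0 F.
have sp : size ('X^q + y%:P) = q.+1.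
  by rewrite size_polyDl size_polyXn // ltnS (leq_trans (size_polyC_leq1 _)).
have [i||z _] := alg_closedK hL (p := 'X^q + y%:P).
- rewrite coefD coefXn coefC; have [->|_] := eqVneq i 0%N.
    by rewrite ltn_eqF // add0r.
  by rewrite addr0 -(rmorph_nat iota); exact: alg_over_K_iota.
- by rewrite sp ltnS.
by rewrite /root !hornerE addr_eq0 => /eqP; exists z.
Qed.

Lemma abs_frob_sub (y z : L) : abs (y ^+ q - z ^+ q) = abs (y - z) ^+ q.
Proof. by rewrite -(frobB qL) (absX hL). Qed.

(** Approximate [z] by [q]-th powers [s n ^+ q]. Since [abs_frob_sub] turns distances into their
    [q]-th powers, the [s n] form a Cauchy sequence, and its limit is the root. *)
Lemma frob_surj (z : L) : exists y : L, y ^+ q = z.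
Proof.
have q0 := finNzRing_gt0 F.
pose e n : R := n.+1%:R^-1.
have e0 n : 0 < e n by rewrite invr_gt0 ltr0n.
have /choice [s hs] n : exists y : L, abs (z - y ^+ q) < e n.
  (* Approximating [- z] compensates for the sign in [alg_over_K_root]. *)
  have [w wa] := alg_denseK hL (- z) (e0 n).
  rewrite -opprD (absN hL) => wz.
  by have [y yw] := alg_over_K_root wa; exists y; rewrite yw opprK.
have small d : 0 < d -> exists N, forall n, (N <= n)%N -> abs (z - s n ^+ q) < d.
  move=> d0; have [k hk] := ltr_add_invr (y := 0) (x := d) d0.
  exists k => n kn; apply: lt_trans (hs n) _; apply: le_lt_trans hk.
  by rewrite add0r lef_pV2 ?posrE ?ltr0n // ler_nat ltnS.
have [l /(converges_toP hL) hl] : converges abs s.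
  apply: (abs_complete hL) => d d0.
  have [N hN] := small _ (exprn_gt0 q d0).
  exists N => m n /hN hm /hN hn.
  rewrite -(@ltr_pXn2r _ q) ?nnegrE ?(abs_ge0 hL) ?(ltW d0) //.
  rewrite -abs_frob_sub (_ : _ - _ = (z - s n ^+ q) - (z - s m ^+ q)); last by ring.
  exact: (abs_sub_lt hL).
exists l; apply/eqP; rewrite -subr_eq0 -(abs_eq0 hL) eq_le (abs_ge0 hL) andbT.
rewrite leNgt; apply/negP => d0.
pose d := abs (l ^+ q - z).
have [N1 h1] := small _ d0.
have [N3 h3] : exists N3, forall n, (N3 <= n)%N -> abs (s n ^+ q - l ^+ q) < d.
  (* Below 1 a [q]-th power does not exceed its base, so the bound by [d] survives the power. *)
  have m0 : 0 < Num.min 1 d by rewrite lt_min ltr01.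
  have [N h] := hl _ m0; exists N => n /h; rewrite lt_min => /andP[u1 ud].
  rewrite abs_frob_sub; apply: le_lt_trans ud.
  by rewrite -{2}[abs _]expr1 ler_wiXn2l ?(abs_ge0 hL) // ltW.
pose n := maxn N1 N3.
have := abs_add_lt hL (h1 n (leq_maxl _ _)) (h3 n (leq_maxr _ _)).
by rewrite addrA subrK (abs_sub hL) ltxx.
Qed.

Local Notation qroot := (Defs.nthroot q).

Lemma qrootK (z : L) : qroot z ^+ q = z.
Proof. by exact: (xgetPex 0 (frob_surj z)). Qed.

Lemma qroot_eq (y z : L) : y ^+ q = z -> qroot z = y.
Proof. by move=> yz; apply: (frob_inj qL); rewrite qrootK. Qed.

Lemma qrootD (y z : L) : qroot (y + z) = qroot y + qroot z.
Proof. by apply: qroot_eq; rewrite (frobD qL) !qrootK. Qed.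

Lemma qrootM (y z : L) : qroot (y * z) = qroot y * qroot z.
Proof. by apply: qroot_eq; rewrite exprMn !qrootK. Qed.

End Roots.

(** * Carlitz polynomials: linearity, normalisation and multiplication by [x] *)

Section CarlitzPolynomials.
Variables (R : realType) (F : finFieldType) (L : fieldType).
Variables (iota : {rmorphism F -> L}) (x : L) (abs : L -> R).
Hypothesis hL : completed_alg_closure iota x abs.
Local Notation q := #|F|.
Hypothesis qL : [pchar L].-nat q.
Local Notation of_poly := (of_poly iota x).
Local Notation e_ := (carlitz_e iota x).
Local Notation f_ := (carlitz_f iota x).
Local Notation D_ := (@carlitz_D F L x).
Local Notation br := (@br F L x).

Lemma carlitz_e0 (t : L) : e_ 0 t = t.
Proof.
rewrite /carlitz_e (eq_bigr (fun=> t)) ?prodr_const ?card_mx ?muln0 ?expn0 //.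
by move=> w _; rewrite (_ : rVpoly w = 0) ?of_poly0 ?subr0 // thinmx0 linear0.
Qed.

Lemma carlitz_e_root (i : nat) (w : {poly F}) :
  (size w <= i)%N -> e_ i (of_poly w) = 0.
Proof.
move=> wi; rewrite /carlitz_e (bigD1 (poly_rV w)) //= poly_rV_K //.
by rewrite subrr mul0r.
Qed.

Lemma carlitz_e_Xn_neq0 (i : nat) : e_ i (x ^+ i) != 0.
Proof.
apply/prodf_neq0 => w _; rewrite -(of_polyXn iota) -of_polyN -of_polyD (of_poly_eq0 hL).
rewrite subr_eq0; apply/eqP => Xw.
have: (size (rVpoly w) <= i)%N by exact: size_poly.
by rewrite -Xw size_polyXn ltnn.
Qed.

(* A polynomial of degree at most i is v + a X^i with deg v < i. *)
Lemma carlitz_e_recr (i : nat) (t : L) :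
  e_ i.+1 t = \prod_(a : F) e_ i (t - iota a * x ^+ i).
Proof.
pose h (u : F * 'rV[F]_i) : 'rV[F]_i.+1 := poly_rV (rVpoly u.2 + u.1 *: 'X^i).
have sz (u : F * 'rV[F]_i) : (size (rVpoly u.2 + u.1 *: 'X^i)%R <= i.+1)%N.
  apply: leq_trans (size_polyD _ _) _; rewrite geq_max.
  rewrite (leq_trans (size_poly _ _)) //=.
  by rewrite (leq_trans (size_scale_leq _ _)) // size_polyXn.
have h_inj : injective h.
  move=> [a v] [b w] /(congr1 rVpoly); rewrite !poly_rV_K ?sz //= => E.
  (* The coefficient of [X^i] recovers the scalar, as the other summand has degree below [i]. *)
  have := congr1 (fun f : {poly F} => f`_i) E.
  rewrite !coefD !coefZ !coefXn eqxx !mulr1.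
  rewrite ![(rVpoly _)`_i]nth_default ?size_poly // !add0r => ab.
  by move: E; rewrite ab => /addIr /(can_inj rVpolyK) ->.
have h_bij : bijective h.
  by apply: inj_card_bij => //; rewrite card_prod !card_mx !mul1n expnS.
rewrite /carlitz_e (reindex h) /=; last exact: onW_bij.
rewrite pair_bigA /=; apply: eq_bigr => u _.
rewrite /h poly_rV_K ?sz // of_polyD of_polyZ of_polyXn.
by rewrite opprD addrA addrAC.
Qed.

(** By linearity each factor [e_ i (t - iota a * x ^+ i)] becomes [e_ i t - iota a * e_ i (x ^+ i)],
    and [prod_sub_iota] applies. Linearity is a premise here because [carlitz_e_linear] obtains it
    inductively from this recursion. *)
Lemma carlitz_eS_linear (i : nat) :
  (forall t s, e_ i (t + s) = e_ i t + e_ i s) ->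
  (forall a t, e_ i (iota a * t) = iota a * e_ i t) ->
  forall t, e_ i.+1 t = e_ i t ^+ q - e_ i (x ^+ i) ^+ q.-1 * e_ i t.
Proof.
move=> eD eZ t; rewrite carlitz_e_recr -(prod_sub_iota iota) ?carlitz_e_Xn_neq0 //.
by apply: eq_bigr => a _; rewrite -mulNr -rmorphN eD eZ rmorphN mulNr.
Qed.

Lemma carlitz_e_linear (i : nat) :
  (forall t s, e_ i (t + s) = e_ i t + e_ i s) /\
  (forall a t, e_ i (iota a * t) = iota a * e_ i t).
Proof.
elim: i => [|i [eD eZ]]; first by split=> *; rewrite !carlitz_e0.
split=> [t s|a t]; rewrite !carlitz_eS_linear //.
  by rewrite eD (frobD qL); ring.
by rewrite eZ exprMn iota_frob; ring.
Qed.

Lemma carlitz_eS (i : nat) (t : L) :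
  e_ i.+1 t = e_ i t ^+ q - e_ i (x ^+ i) ^+ q.-1 * e_ i t.
Proof. by have [eD eZ] := carlitz_e_linear i; exact: carlitz_eS_linear. Qed.

Lemma br0 : br 0 = 0.
Proof. by rewrite /Defs.br /= expr1 subrr. Qed.

Lemma brS (i : nat) : br 1 + br i ^+ q = br i.+1.
Proof. by rewrite /Defs.br /= (frobB qL) expn1 -exprM -expnSr; ring. Qed.

Lemma carlitz_D0 : D_ 0 = 1.
Proof. by rewrite /carlitz_D big_ord0. Qed.

Lemma carlitz_DS (i : nat) : D_ i.+1 = br i.+1 * D_ i ^+ q.
Proof.
rewrite /carlitz_D big_ord_recl expn0 expr1 subn0 -prodrXl; congr (_ * _).
by apply: eq_bigr => k _; rewrite /= /bump add1n subSS -exprM expnSr.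
Qed.

Lemma expr_pred_card (y : L) : y ^+ q.-1 * y = y ^+ q.
Proof. by rewrite -exprSr prednK // finNzRing_gt0. Qed.

(* Evaluating the second identity at t = x^i yields the first one for i + 1,
   since e_(i+1)(x^i) = 0. *)
Lemma carlitz_e_mulx_aux (i : nat) :
  e_ i (x ^+ i) = D_ i /\
  forall t, e_ i.+1 (x * t) = x * e_ i.+1 t + br i.+1 * e_ i t ^+ q.
Proof.
elim: i => [|i [eD eM]].
  split=> [|t]; first by rewrite carlitz_e0 carlitz_D0.
  by rewrite !carlitz_eS !carlitz_e0 /Defs.br /= expr1n exprMn expn1; ring.
have eDS : e_ i.+1 (x ^+ i.+1) = D_ i.+1.
  rewrite exprS eM -(of_polyXn iota) carlitz_e_root ?size_polyXn // mulr0 add0r.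
  by rewrite of_polyXn eD carlitz_DS.
split=> // t.
rewrite !(carlitz_eS i.+1) eDS eM !(frobD qL) -(brS i.+1) [(x * _) ^+ q]exprMn.
set b := br i.+1; set y := e_ i t ^+ q.
(* Since [D_ i.+1 = b * D_ i ^+ q], the part containing [y] is [b ^+ q] times a [q]-th power; it is
   the same power that appears in [e_ i.+1 t ^+ q] below, so the two combine. *)
have -> : D_ i.+1 ^+ q.-1 * (x * e_ i.+1 t + b * y)
  = D_ i.+1 ^+ q.-1 * x * e_ i.+1 t + b ^+ q * (D_ i ^+ q.-1 * e_ i t) ^+ q.
  rewrite mulrDr mulrA; congr (_ + _); rewrite carlitz_DS -/b.
  by rewrite -[b ^+ q]expr_pred_card !exprMn -/y [(_ ^+ q) ^+ q.-1]exprAC; ring.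
have -> : e_ i.+1 t ^+ q = y ^+ q - (D_ i ^+ q.-1 * e_ i t) ^+ q.
  by rewrite carlitz_eS eD (frobB qL).
rewrite [br 1]/Defs.br /= expn1 !exprMn; ring.
Qed.

Lemma carlitz_e_Xn (i : nat) : e_ i (x ^+ i) = D_ i.
Proof. by case: (carlitz_e_mulx_aux i). Qed.

Lemma carlitz_e_mulx (i : nat) (t : L) :
  e_ i.+1 (x * t) = x * e_ i.+1 t + br i.+1 * e_ i t ^+ q.
Proof. by case: (carlitz_e_mulx_aux i). Qed.

Lemma carlitz_D_neq0 (i : nat) : D_ i != 0.
Proof. by rewrite -carlitz_e_Xn carlitz_e_Xn_neq0. Qed.

Lemma br_neq0 (i : nat) : br i.+1 != 0.
Proof. by have := carlitz_D_neq0 i.+1; rewrite carlitz_DS mulf_eq0 => /norP[]. Qed.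

Lemma carlitz_f_Xn (i : nat) : f_ i (x ^+ i) = 1.
Proof. by rewrite /carlitz_f carlitz_e_Xn mulVf ?carlitz_D_neq0. Qed.

Lemma carlitz_fS_frob (i : nat) (t : L) :
  f_ i t ^+ q = f_ i t + br i.+1 * f_ i.+1 t.
Proof.
rewrite /carlitz_f carlitz_DS carlitz_eS carlitz_e_Xn exprMn exprVn.
have := carlitz_D_neq0 i; have := br_neq0 i.
rewrite -expr_pred_card; set d := _ ^+ q.-1 => b0 D0.
have d0 : d != 0 by rewrite expf_neq0.
by field; rewrite D0 d0.
Qed.

Lemma carlitz_f_mulx (i : nat) (t : L) :
  f_ i.+1 (x * t) - x * f_ i.+1 t = f_ i t ^+ q.
Proof.
rewrite /carlitz_f carlitz_e_mulx carlitz_DS exprMn exprVn.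
have b0 := br_neq0 i; have D0 : D_ i ^+ q != 0 by rewrite expf_neq0 ?carlitz_D_neq0.
by field; rewrite D0.
Qed.

Lemma carlitz_f0_mulx (t : L) : f_ 0 (x * t) - x * f_ 0 t = 0.
Proof. by rewrite /carlitz_f !carlitz_e0 carlitz_D0; ring. Qed.

(** * Operators on Carlitz series and the coefficient recursion *)

Local Notation u_ := (carlitz_sum iota x).

Lemma carlitz_sum_widen (c : nat -> L) (t : {poly F}) (n : nat) :
  (size t <= n)%N -> u_ c t = \sum_(i < n) c i * f_ i (of_poly t).
Proof.
move=> tn; rewrite /carlitz_sum -!(big_mkord xpredT (fun i => c i * f_ i (of_poly t))).
rewrite [RHS](big_cat_nat (leq0n _) tn) //=.
rewrite [X in _ + X]big_nat [X in _ + X]big1 ?addr0 //.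
by move=> i /andP[ti _]; rewrite carlitz_f_eq0 ?mulr0.
Qed.

(** Evaluation is unitriangular: at ['X^i] the later terms vanish by degree and the earlier ones by
    induction. *)
Lemma carlitz_sum_eq0 (c : nat -> L) :
  (forall t, u_ c t = 0) -> forall i, c i = 0.
Proof.
move=> h; elim/ltn_ind => i IH; have := h 'X^i.
rewrite (@carlitz_sum_widen _ _ i.+1) ?size_polyXn // big_ord_recr big1 /=.
  by rewrite add0r of_polyXn carlitz_f_Xn mulr1.
by move=> k _; rewrite IH ?mul0r.
Qed.

(** Keeping the [q]-th powers of the [f_ i] unexpanded makes the root in [carlitz_d] act term by
    term. The index shifts because [f_ 0] is killed by [carlitz_Delta]. *)
Lemma carlitz_Delta_sum_frob (c : nat -> L) (t : {poly F}) (m : nat) :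
  (size t <= m)%N ->
  carlitz_Delta x (u_ c) t = \sum_(i < m) c i.+1 * f_ i (of_poly t) ^+ q.
Proof.
move=> tm; rewrite /carlitz_Delta !(@carlitz_sum_widen _ _ m.+1) ?(leqW tm) //.
  rewrite of_polyM of_polyX mulr_sumr -sumrB big_ord_recl.
  rewrite [_ - _](_ : _ = 0) ?add0r; last first.
    by rewrite [x * (_ * _)]mulrCA -mulrBr carlitz_f0_mulx mulr0.
  by apply: eq_bigr => i _; rewrite [x * (_ * _)]mulrCA -mulrBr carlitz_f_mulx.
by rewrite (leq_trans (size_polyMleq _ _)) // size_polyX.
Qed.

Lemma carlitz_Delta_sum (c : nat -> L) :
  carlitz_Delta x (u_ c) = u_ (fun i => c i * br i + c i.+1).
Proof.
apply/funext => t; rewrite (carlitz_Delta_sum_frob _ (leqnn _)).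
under eq_bigr do rewrite carlitz_fS_frob mulrDr mulrA.
rewrite /carlitz_sum; under [RHS]eq_bigr do rewrite mulrDl.
rewrite !big_split /= addrC; congr (_ + _).
(* The shift costs nothing: the added top term vanishes by degree, the bottom one because
   [br 0 = 0]. *)
have := @big_ord_recl _ 0 +%R (size t)
  (fun i : 'I_(size t).+1 => c i * br i * f_ i (of_poly t)).
rewrite big_ord_recr /= carlitz_f_eq0 // mulr0 addr0 br0 mulr0 mul0r add0r.
by move=> ->; apply: eq_bigr.
Qed.

Lemma carlitz_Delta_sub_sum (alpha : L) (c : nat -> L) :
  carlitz_Delta_sub x alpha (u_ c) = u_ (fun i => c i * (br i - alpha) + c i.+1).
Proof.
apply/funext => t; rewrite /carlitz_Delta_sub carlitz_Delta_sum /carlitz_sum.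
by rewrite mulr_sumr -sumrB; apply: eq_bigr => i _; ring.
Qed.

Lemma carlitz_d_sum (c : nat -> L) :
  carlitz_d x (u_ c) = u_ (fun i => Defs.nthroot q (c i.+1)).
Proof.
apply/funext => t; apply: (qroot_eq hL qL).
rewrite (carlitz_Delta_sum_frob _ (leqnn _)) (frob_sum qL).
by apply: eq_bigr => i _; rewrite exprMn (qrootK hL qL).
Qed.

Lemma hypergeometric_rec_eq (a b : int) (c : nat -> L) :
  hypergeometric_rec F x a b c <-> hypergeometric_eq x a b (u_ c).
Proof.
rewrite /hypergeometric_eq carlitz_Delta_sum carlitz_d_sum !carlitz_Delta_sub_sum.
set A := (X in carlitz_sum _ _ X).
set B := fun i => Defs.nthroot q (c i.+1 * br i.+1 + c i.+2).
(* [A] and [B] are the coefficients of the left and right sides of the equation; the recursion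
   states that they agree. *)
have AB i : B i - A i =
    (Defs.nthroot q (c i.+2) - c i.+2)
    + Defs.nthroot q (c i.+1) * Defs.nthroot q (br i.+1)
    - c i.+1 * (br i + br i.+1 - br (- a) - br (- b))
    - c i * (br i - br (- a)) * (br i - br (- b)).
  by rewrite /A /B (qrootD hL qL) (qrootM hL qL); ring.
split=> [h t|h i].
  by apply: eq_bigr => i _; congr (_ * _); apply/esym/eqP; rewrite -subr_eq0 AB h.
rewrite -AB; apply: (carlitz_sum_eq0 (c := fun i => B i - A i)) => t.
rewrite /carlitz_sum; under eq_bigr do rewrite mulrBl.
by rewrite sumrB; apply/eqP; rewrite subr_eq0; apply/eqP/esym; exact: h.
Qed.

(** * Strong singularity *)

Lemma abs_carlitz_f_eq1 (t : L) (w : {poly F}) (i : nat) :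
  (size w <= i)%N -> abs (t - of_poly w) = abs x ^+ i -> abs (f_ i t) = 1.
Proof.
move=> wi tw; rewrite /carlitz_f (absM hL) (absV hL) -carlitz_e_Xn.
suff -> : abs (e_ i t) = abs (e_ i (x ^+ i)).
  by rewrite mulVf // (abs_eq0 hL) carlitz_e_Xn_neq0.
have -> : e_ i t = e_ i (t - of_poly w).
  rewrite (carlitz_e_linear i).1 -of_polyN carlitz_e_root ?size_polyN //.
  by rewrite addr0.
(* The products for [t - of_poly w] and [x ^+ i] agree factor by factor: both elements have absolute
   value [abs x ^+ i], and any non-zero polynomial of degree below [i] is larger and dominates. *)
rewrite /carlitz_e !(abs_prod hL); apply: eq_bigr => v _.
have [->|v0] := eqVneq (rVpoly v) 0; first by rewrite of_poly0 !subr0 (absX hL).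
have vx := abs_of_poly_gt hL v0 (size_poly _ _).
have dom s : abs s = abs x ^+ i ->
    abs (s - of_poly (rVpoly v)) = abs (of_poly (rVpoly v)).
  by move=> sx; rewrite addrC (abs_add_dominant hL) (absN hL) // sx.
by rewrite !dom ?(absX hL).
Qed.

Lemma integral_nonpoly_coef (N : int) (xi : int -> F) (t : L) (n : nat) :
  laurent_sum iota x abs N xi t -> abs t <= 1 -> ~ in_Fqx iota x t ->
  exists k, let m := (n + k + `|N|)%N in xi (N + m%:Z) != 0.
Proof.
move=> ht t1 nt; apply: contrapT => h; apply: nt.
(* If every coefficient from this exponent on were zero, [t] would equal its partial sum, a
   polynomial. The summand [|N|] makes the exponent non-negative. *)
have [j Nj] : exists j : nat, N + (n + `|N|)%N%:Z = j%:Z.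
  by exists (absz (N + (n + `|N|)%N%:Z)); lia.
have [w _ ew] := laurent_partial_poly hL ht t1 Nj.
exists w; rewrite -ew; apply/eqP; rewrite -subr_eq0; apply/eqP.
apply: (laurent_sum_unique0 hL) (laurent_sum_tail hL _ ht) => k.
apply/eqP/negPn/negP => xk; apply: h; exists k => /=.
by congr (xi _ != 0): xk; lia.
Qed.

Lemma abs_carlitz_f_frequently_eq1 (t : L) (n : nat) :
  in_O iota x abs t -> ~ in_Fqx iota x t ->
  exists2 i : nat, (n <= i)%N & abs (f_ i t) = 1.
Proof.
move=> [[N [xi ht]] t1] nt.
have [k /= xk] := integral_nonpoly_coef (n + `|N|) ht t1 nt.
set m := (n + `|N| + k + `|N|)%N in xk.
have [i Ni ni] : exists2 i : nat, N + m%:Z = i%:Z & (n <= i)%N.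
  by exists (absz (N + m%:Z)); rewrite /m; lia.
exists i => //; have [w wi ew] := laurent_partial_poly hL ht t1 Ni.
apply: (abs_carlitz_f_eq1 wi); rewrite -ew.
rewrite (abs_laurent hL (laurent_sum_tail hL m ht) xk) Ni.
by rewrite (abs_x hL) exprVn exprnN.
Qed.

Lemma unit_coef_strongly_singular (c : nat -> L) :
  (exists N : nat, forall n, (N <= n)%N -> abs (c n) = 1) ->
  strongly_singular iota x abs c.
Proof.
move=> [N cN] t tO tF [l /(converges_toP hL) /(_ _ ltr01) [M hM]].
have [i] := abs_carlitz_f_frequently_eq1 (maxn N M) tO tF.
rewrite geq_max => /andP[Ni Mi] fi.
(* Two consecutive partial sums within distance less than 1 of [l] differ by [c i * f_ i t], which
   has absolute value 1. *)
have := abs_sub_lt hL (hM _ (leqW Mi)) (hM _ Mi).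
rewrite big_ord_recr /= opprB addrA subrK addrAC subrr add0r.
by rewrite (absM hL) cN // fi mulr1 ltxx.
Qed.

End CarlitzPolynomials.

Theorem theorem4 (R : realType) (p r : nat) (p_prime : prime p) (r_gt0 : (0 < r)%N)
    (F : finFieldType) (cardF : #|F| = (p ^ r)%N)
    (L : fieldType) (iota : {rmorphism F -> L}) (x : L) (abs : L -> R)
    (hL : completed_alg_closure iota x abs) (a b : int) :
  forall c : nat -> L,
    (hypergeometric_rec F x a b c <->
     hypergeometric_eq x a b (carlitz_sum iota x c)) /\
    (generic_solution F x abs a b c -> strongly_singular iota x abs c).
Proof.
have qL := pchar_card_pnat iota p_prime cardF.
move=> c; split; first exact: (hypergeometric_rec_eq hL qL).
by move=> [_]; exact: (unit_coef_strongly_singular hL qL).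
Qed.
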